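(* Let $p$ be an odd prime and let $H,N$ be integers with $0\le H<H+N<p$. For $a\in\mathbb{F}_p^*$ let $F(a,H,N)$ be the number of integers $n$ with $H+1\le n\le H+N$ and $n!\equiv a\pmod p$. Then $$\max_{a\in\mathbb{F}_p^*}F(a,H,N)\ll N^{2/3}.$$
   Context: The implied constant is absolute. *)

(* Defs.v *)
From mathcomp Require Import all_boot all_order all_algebra.
From mathcomp Require Import reals exp.

Set Implicit Arguments.
Unset Strict Implicit.
Unset Printing Implicit Defensive.

Import Order.TTheory GRing.Theory Num.Theory.

Local Open Scope ring_scope.

Definition fact_count (p : nat) (a : 'F_p) (H N : nat) : nat :=
  count (fun n : nat => (n`!)%:R == a) (index_iota (H + 1)%N (H + N + 1)%N).

(* On nat, \max is the big operator with default 0; the index set {a != 0} is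
   nonempty, so this is the genuine maximum. *)
Definition max_fact_count (p H N : nat) : nat :=
  (\max_(a : 'F_p | a != 0%R) fact_count a H N)%N.

(* Main.v *)
Require Import Defs.
From mathcomp Require Import all_boot all_order all_algebra.
From mathcomp Require Import reals exp.
From mathcomp Require Import zify.

Import Order.TTheory GRing.Theory Num.Theory.

Local Open Scope ring_scope.

(** If [n! = (n + d)! = a <> 0] in [F_p], then [n] is a root of the degree-[d]
    polynomial [(X + 1) ... (X + d) - 1], so at most [d] values [n < p] have a
    further solution at distance exactly [d]. Hence at most [D ^ 2] solutions are
    followed by another one at distance at most [D]; the others are
    [(D + 1)]-separated, so there are at most [(N - 1) / (D + 1) + 1] of them.
    Take [D] to be the integer part of the cube root of [N]. *)

(** Writing each factor [X + i] as [X - (- i)] gives the shape that [size_prod_XsubC] handles. *)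
Definition shifted_product (R : nzRingType) (d : nat) : {poly R} :=
  \prod_(i <- iota 1 d) ('X - (- i%:R)%:P).

Lemma size_shifted_product (R : nzRingType) d :
  size (shifted_product R d) = d.+1.
Proof.
by rewrite /shifted_product size_prod_XsubC size_iota.
Qed.

Lemma fact_shifted_product (R : comNzRingType) n d :
  ((n + d)`!)%:R = (n`!)%:R * (shifted_product R d).[n%:R].
Proof.
elim: d => [|d IHd].
  by rewrite addn0 /shifted_product big_nil hornerC mulr1.
rewrite addnS factS natrM IHd /shifted_product -[d.+1]addn1 iotaD big_cat /=.
rewrite big_cons big_nil mulr1 hornerM hornerXsubC opprK -natrD.
by rewrite add1n addnS mulrC mulrA.
Qed.

Lemma Fp_natr_inj_in p : prime p -> {in gtn p &, injective (fun n => n%:R : 'F_p)}.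
Proof.
move=> p_pr m n; rewrite !inE => m_lt n_lt /(congr1 val) /=.
by rewrite !val_Fp_nat // !modn_small.
Qed.

Lemma count_fact_shift p (a : 'F_p) d (s : seq nat) :
  prime p -> a != 0 -> (0 < d)%N -> uniq s -> {subset s <= gtn p} ->
  (count (fun n => ((n`!)%:R == a) && (((n + d)`!)%:R == a)) s <= d)%N.
Proof.
move=> p_pr a_neq0 d_gt0 s_uniq s_lt.
set P := fun n => _; pose q := shifted_product 'F_p d - 1.
have size_q : size q = d.+1.
  (* Since [d > 0], subtracting the constant 1 does not change the degree. *)
  by rewrite size_polyDl size_shifted_product // size_polyN size_poly1.
rewrite -size_filter -(size_map (fun n => n%:R : 'F_p)) -ltnS -size_q.
apply: max_poly_roots.
- by rewrite -size_poly_eq0 size_q.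
- apply/allP=> _ /mapP[n + ->]; rewrite mem_filter => /andP[/andP[/eqP na /eqP nda] _].
  rewrite /root hornerD hornerN hornerC subr_eq0; apply/eqP/(mulfI a_neq0).
  by rewrite mulr1 -{1}na -fact_shifted_product.
(* Reduction mod [p] is injective below [p], so distinct solutions give distinct roots. *)
- rewrite map_inj_in_uniq ?filter_uniq // => m n.
  rewrite !mem_filter => /andP[_ /s_lt m_lt] /andP[_ /s_lt n_lt].
  exact: Fp_natr_inj_in.
Qed.

(** Union bound, used below with [r] the list of distances. *)
Lemma count_has_le_sum (T I : Type) (P : I -> pred T) (r : seq I) (s : seq T) :
  (count (fun x => has (P^~ x) r) s <= \sum_(i <- r) count (P i) s)%N.
Proof.
elim: r => [|i r IHr]; first by rewrite big_nil /= count_pred0.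
rewrite big_cons; apply: leq_trans (leq_add (leqnn _) IHr).
by rewrite -count_predUI leq_addr.
Qed.

(** Pigeonhole: cut the interval into blocks of length [D + 1], each holding at most one point of
    [P]. The offsets run up to [N - 1], so the last block has index [(N - 1) %/ (D + 1)]. *)
Lemma count_separated (P : pred nat) m N D :
  (0 < N)%N ->
  (forall n d, P n -> (0 < d <= D)%N -> ~~ P (n + d)%N) ->
  (count P (iota m N) <= (N.-1 %/ D.+1).+1)%N.
Proof.
move=> N_gt0 sepP; pose f n := ((n - m) %/ D.+1)%N.
rewrite -size_filter -(size_map f) -[X in (_ <= X)%N](size_iota 0).
apply: uniq_leq_size => [|_ /mapP[n + ->]]; last first.
  rewrite mem_filter !mem_iota => /andP[_ n_in].
  by rewrite add0n ltnS leq_div2r //; lia.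
rewrite map_inj_in_uniq ?filter_uniq ?iota_uniq // => x y.
rewrite !mem_filter !mem_iota => /andP[Px x_in] /andP[Py y_in].
(* Two points of one block differ by at most [D], so the larger one would violate [sepP]. *)
have sep u v : P u -> P v -> (m <= u)%N -> (u < v)%N -> f u <> f v.
  move=> Pu Pv mu uv; rewrite /f => fuv.
  have := sepP u (v - u)%N Pu; rewrite subnKC ?(ltnW uv) // Pv.
  have := divn_eq (u - m) D.+1; have := divn_eq (v - m) D.+1.
  have := ltn_pmod (u - m) (ltn0Sn D); have := ltn_pmod (v - m) (ltn0Sn D).
  rewrite fuv; move: (_ %/ _ * _)%N (_ %% _)%N (_ %% _)%N => A B C.
  by move=> ? ? ? ? /implyP; lia.
case: (ltngtP x y) => // xy fxy; first by case: (sep x y Px Py) => //; lia.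
by case: (sep y x Py Px) => //; lia.
Qed.

Lemma fact_count_le p (a : 'F_p) H N D :
  prime p -> a != 0 -> (0 < N)%N -> (H + N < p)%N ->
  (fact_count a H N <= D ^ 2 + (N.-1 %/ D.+1).+1)%N.
Proof.
move=> p_pr a_neq0 N_gt0 HN_lt; rewrite /fact_count /index_iota.
have -> : (H + N + 1 - (H + 1) = N)%N by lia.
set P := fun n => _; set s := iota _ _.
pose B n := has (fun d => P n && P (n + d)%N) (iota 1 D).
have B_le : (count B s <= D ^ 2)%N.
  apply: leq_trans (@count_has_le_sum _ _ (fun d n => P n && P (n + d)%N) _ _) _.
  (* Distance [d] contributes at most [d], bounded crudely by [D]. *)
  apply: (@leq_trans (\sum_(d <- iota 1 D) D)); last first.
    by rewrite big_const_seq count_predT size_iota iter_addn_0.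
  rewrite big_seq [X in (_ <= X)%N]big_seq; apply: leq_sum => d.
  rewrite mem_iota => d_in; apply: (@leq_trans d); last by lia.
  apply: count_fact_shift => //; [by lia | exact: iota_uniq | ].
  by move=> n; rewrite mem_iota inE; lia.
(* If [n] and [n + d] both satisfied [Q] with [0 < d <= D], then [d] would witness [B n]. *)
pose Q n := P n && ~~ B n.
have Q_le : (count Q s <= (N.-1 %/ D.+1).+1)%N.
  apply: count_separated => // n d /andP[Pn /hasPn nB] d_in.
  apply/negP => /andP[Pnd _]; have := nB d.
  by rewrite mem_iota Pn Pnd; lia.
apply: leq_trans (leq_add B_le Q_le); rewrite -count_predUI.
apply: leq_trans (leq_addr _ _); apply: sub_count => n /= Pn.
by rewrite /Q Pn /= orbN.
Qed.

Lemma floor_root N k : (0 < k)%N -> exists D, (D ^ k <= N < D.+1 ^ k)%N.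
Proof.
move=> k_gt0; elim: N => [|N [D /andP[DN ND]]].
  by exists 0; rewrite exp0n // exp1n.
(* Either the old root still works, or [N + 1] has reached the next [k]-th power. *)
have [N1D|DN1] := ltnP N.+1 (D.+1 ^ k); first by exists D; rewrite N1D ltnW.
by exists D.+1; rewrite DN1 (leq_ltn_trans ND) // ltn_exp2r.
Qed.

Theorem theorem12 (R : realType) :
  exists C : R, 0 < C /\
    forall p H N : nat,
      prime p -> odd p -> (0 <= H)%N -> (H < H + N)%N -> (H + N < p)%N ->
      (max_fact_count p H N)%:R <= C * N%:R `^ (2 / 3).
Proof.
(* The constant comes from [D ^ 2 + (D + 1) ^ 2 <= 5 * D ^ 2], valid for [D >= 1]. *)
exists 5; split=> // p H N p_pr _ _ N_gt0 HN_lt.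
have {}N_gt0 : (0 < N)%N by lia.
have [D /andP[DN ND]] := @floor_root N 3 isT.
have D_gt0 : (0 < D)%N by case: D DN ND => //; lia.
have max_le : (max_fact_count p H N <= 5 * D ^ 2)%N.
  apply/bigmax_leqP => a a_neq0.
  apply: leq_trans (@fact_count_le p a H N D p_pr a_neq0 N_gt0 HN_lt) _.
  (* This uses [N < (D + 1) ^ 3]; strictness absorbs the extra 1 in the bound on separated
     solutions. *)
  have : (N.-1 %/ D.+1 < D.+1 ^ 2)%N by rewrite ltn_divLR // -expnSr; lia.
  by nia.
have D2_le : (D ^ 2)%:R <= N%:R `^ (2 / 3) :> R.
  have -> : (D ^ 2)%:R = (D ^ 3)%:R `^ (2 / 3) :> R.
    rewrite !natrX -!powR_mulrn ?ler0n // -powRrM mulrCA divff ?mulr1 //.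
    by rewrite pnatr_eq0.
  by rewrite ge0_ler_powR ?nnegrE ?ler0n ?ler_nat // divr_ge0.
apply: le_trans (_ : (5 * D ^ 2)%:R <= _); first by rewrite ler_nat.
by rewrite natrM ler_wpM2l.
Qed.
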